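(* Let $\mathrm{A}$ be a complex $3$-dimensional metabelian commutative algebra. Then $\mathrm{A}$ is isomorphic to one of the following commutative algebras with basis $e_1,e_2,e_3$ (where $\alpha\in\mathbb{C}$): - $\mathrm{M}_{01}$: $e_1e_1=e_2$; - $\mathrm{M}_{02}$: $e_1e_2=e_3$; - $\mathrm{M}_{03}$: $e_1e_1=e_2$, $e_1e_2=e_3$; - $\mathrm{M}_{04}^{\alpha}$: $e_1e_3=e_1$, $e_2e_3=\alpha e_2$; - $\mathrm{M}_{05}$: $e_1e_3=e_1$, $e_3e_3=e_2$; - $\mathrm{M}_{06}$: $e_1e_3=e_1+e_2$, $e_2e_3=e_2$; - $\mathrm{M}_{07}$: $e_1e_3=e_1$, $e_2e_2=e_1$. All these algebras are non-isomorphic, except that $\mathrm{M}_{04}^{\alpha}\cong\mathrm{M}_{04}^{\alpha^{-1}}$. The algebras $\mathrm{M}_{01}$, $\mathrm{M}_{02}$ and $\mathrm{M}_{03}$ are associative.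
   Context: An algebra is a vector space over $\mathbb{C}$ with a bilinear multiplication (not assumed associative). An algebra is metabelian if it satisfies the identity $(xy)(zt)=0$. In the multiplication tables of commutative algebras, products of basis elements that are zero or that follow from the listed ones by commutativity are omitted. The expression $\alpha^{-1}$ refers to nonzero $\alpha$.
   Formalization: The algebra A is assumed to have a nonzero product: the 3-dimensional algebra with zero multiplication is metabelian and commutative but is isomorphic to none of the listed algebras, so it is excluded. *)

(* Defs.v *)
From HB Require Import structures.
From mathcomp Require Import all_boot all_order all_algebra.
From mathcomp Require Import sesquilinear complex reals.

Set Implicit Arguments.
Unset Strict Implicit.
Unset Printing Implicit Defensive.

Import GRing.Theory.
Local Open Scope ring_scope.

Record algebra (K : fieldType) := Algebra {
  carrier :> vectType K;
  amul : {bilinear carrier -> carrier -> carrier}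
}.
Arguments amul {K} A : rename.

Section Properties.
Variable K : fieldType.
Implicit Types A B : algebra K.

Definition commutative_algebra A := commutative (amul A).

Definition associative_algebra A := associative (amul A).

Definition metabelian_algebra A :=
  forall x y z t : A, amul A (amul A x y) (amul A z t) = 0.

(* Commutative and metabelian, but listed in none of the tables below: the
   classification concerns algebras with a nonzero product. *)
Definition zero_algebra A := forall x y : A, amul A x y = 0.

Definition isomorphic A B :=
  exists f : {linear A -> B},
    bijective f /\ forall x y : A, f (amul A x y) = amul B (f x) (f y).

End Properties.

(* The commutative algebra on K^3 given by a multiplication table. The entry
   ((i, j), v) of the table s stands for e_i e_j = v, with i and j in {1, 2, 3};
   the products e_j e_i follow by commutativity and all others are zero. A table
   lists each unordered pair {i, j} at most once, so that the sum in [table_prod]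
   has at most one term. *)
Section Table.
Variable K : fieldType.
Implicit Types (s : seq (nat * nat * 'rV[K]_3)) (x y : 'rV[K]_3).

(* e_k for k in {1, 2, 3}; coordinates are numbered from 0. *)
Definition e (k : nat) : 'rV[K]_3 := \row_(j < 3) (j.+1 == k)%:R.

Definition table_prod s (i j : nat) : 'rV[K]_3 :=
  \sum_(p <- s | (p.1 == (i, j)) || (p.1 == (j, i))) p.2.

Definition table_mul s x y : 'rV[K]_3 :=
  \sum_(i < 3) \sum_(j < 3) (x 0 i * y 0 j) *: table_prod s i.+1 j.+1.

Lemma table_mul_bilinear s : bilinear_for *:%R *:%R (table_mul s).
Proof.
split=> u a v w /=; rewrite /applyr /table_mul scaler_sumr -big_split;
  apply: eq_bigr => i _ /=; rewrite scaler_sumr -big_split; apply: eq_bigr => j _ /=;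
  rewrite !mxE scalerA -scalerDl; congr (_ *: _).
  by rewrite mulrDl mulrA.
by rewrite mulrDr mulrCA.
Qed.

HB.instance Definition _ s :=
  bilinear_isBilinear.Build K 'rV[K]_3 'rV[K]_3 'rV[K]_3 *:%R *:%R
    (table_mul s) (table_mul_bilinear s).

Definition table_algebra s : algebra K := @Algebra K 'rV[K]_3 (table_mul s).

Lemma table_algebraC s : commutative_algebra (table_algebra s).
Proof.
move=> x y; rewrite /= /table_mul exchange_big; apply: eq_bigr => i _ /=.
apply: eq_bigr => j _; rewrite mulrC; congr (_ *: _).
by apply: eq_bigl => p; rewrite orbC.
Qed.

Lemma table_algebra_basis s (i j : 'I_3) :
  amul (table_algebra s) (e i.+1) (e j.+1) = table_prod s i.+1 j.+1.
Proof.
have eE (k l : 'I_3) : @e k.+1 0 l = (l == k)%:R by rewrite mxE eqSS.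
rewrite /= /table_mul (bigD1 i) //= (bigD1 j) //= !eE !eqxx mulr1 scale1r.
rewrite !big1 ?addr0 // => k; last by move=> /negPf kj; rewrite eE kj mulr0 scale0r.
by move=> /negPf ki; apply: big1 => l _; rewrite eE ki mul0r scale0r.
Qed.

End Table.

Arguments e {K} k.

Inductive label (K : Type) :=
  | M01 | M02 | M03 | M04 (alpha : K) | M05 | M06 | M07.
Arguments M01 {K}.
Arguments M02 {K}.
Arguments M03 {K}.
Arguments M05 {K}.
Arguments M06 {K}.
Arguments M07 {K}.

Definition table (K : fieldType) (l : label K) : seq (nat * nat * 'rV[K]_3) :=
  match l with
  | M01 => [:: ((1, 1)%N, e 2)]
  | M02 => [:: ((1, 2)%N, e 3)]
  | M03 => [:: ((1, 1)%N, e 2); ((1, 2)%N, e 3)]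
  | M04 alpha => [:: ((1, 3)%N, e 1); ((2, 3)%N, alpha *: e 2)]
  | M05 => [:: ((1, 3)%N, e 1); ((3, 3)%N, e 2)]
  | M06 => [:: ((1, 3)%N, e 1 + e 2); ((2, 3)%N, e 2)]
  | M07 => [:: ((1, 3)%N, e 1); ((2, 2)%N, e 1)]
  end.

Definition Malg (K : fieldType) (l : label K) : algebra K := table_algebra (table l).

(* Main.v *)
Require Import Defs.
From HB Require Import structures.
From mathcomp Require Import all_boot all_order all_algebra.
From mathcomp Require Import sesquilinear complex reals boolp ring.

(* Let D be the derived space A^2. As D D = 0 and A is not the zero algebra, D has
   dimension 1 or 2.
   If D is spanned by v, then x y = B(x, y) v for a symmetric bilinear form B with
   B(v, v) = 0, and one normalizes B according to whether v lies in its radical.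
   If D is a plane and w lies outside of it, the algebra is given by the operator
   T = (w .) on D and by w w, which modulo the choice of w is a vector of D modulo
   the image of T; one triangularizes T and splits according to its eigenvalues.
   The algebras of the list are separated by associativity, by the existence of a
   nonzero annihilator, by whether D is at most a line, by whether isotropic vectors
   (x x = 0) annihilate each other, and by the ratio of the eigenvalues of T. *)

Set Implicit Arguments.
Unset Strict Implicit.
Unset Printing Implicit Defensive.

Import GRing.Theory Num.Theory.
Local Open Scope ring_scope.

(** * Isomorphisms of algebras and bases realizing a table *)

Section Isomorphisms.
Variable K : fieldType.
Implicit Types A B : algebra K.

Lemma isomorphic_refl A : isomorphic A A.
Proof. by exists (idfun : {linear A -> A}); split=> //; exists id. Qed.

Lemma isomorphic_sym A B : isomorphic A B -> isomorphic B A.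
Proof.
move=> [f [[g fK gK] fM]].
have gl : linear g by apply: can2_linear fK gK.
pose gL := GRing.isLinear.Build K B A *:%R g gl.
exists (HB.pack g gL : {linear B -> A}); split=> /=; first by exists f.
by move=> x y; apply: (can_inj fK); rewrite gK fM !gK.
Qed.

(** The coordinate map of [b] is the isomorphism: by bilinearity it respects products as soon as it
    does so on pairs of basis vectors. *)
Lemma isomorphic_table A (s : seq (nat * nat * 'rV[K]_3)) (b : 3.-tuple A) :
    basis_of fullv b ->
    (forall i j : 'I_3, amul A b`_i b`_j =
       \sum_(k < 3) table_prod s i.+1 j.+1 0 k *: b`_k) ->
  isomorphic A (table_algebra s).
Proof.
move=> bP bM; have bF := basis_free bP.
pose f x : 'rV[K]_3 := \row_i coord b i x.
have fl : linear f by move=> a x y; apply/rowP=> i; rewrite !mxE linearP.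
pose fL := GRing.isLinear.Build K A 'rV[K]_3 *:%R f fl.
pose F : {linear A -> 'rV[K]_3} := HB.pack f fL.
have fb (v : 'rV[K]_3) : f (\sum_(k < 3) v 0 k *: b`_k) = v.
  by apply/rowP=> i; rewrite mxE coord_sum_free.
have xE x : x = \sum_i coord b i x *: b`_i := coord_basis bP (memvf x).
exists F; split.
  exists (fun v : 'rV[K]_3 => \sum_(k < 3) v 0 k *: b`_k) => [x|v]; last exact: fb.
  by rewrite [RHS]xE; apply: eq_bigr => i _; rewrite mxE.
move=> x y; change (F (amul A x y) = table_mul s (f x) (f y)).
rewrite /table_mul {1}[x]xE {1}[y]xE.
rewrite linear_sumlz linear_sum; apply: eq_bigr => i _.
rewrite linear_sumr linear_sum; apply: eq_bigr => j _.
rewrite linearZl_LR !linearZ /= scalerA !mxE; congr (_ *: _).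
by rewrite bM fb.
Qed.

End Isomorphisms.

(** * Coordinates in the listed algebras *)

Section Coordinates.
Variable K : fieldType.

Definition vec3 (a b c : K) : 'rV[K]_3 := \row_(j < 3) [:: a; b; c]`_j.

Lemma vec3_eta (v : 'rV[K]_3) : exists a b c, v = vec3 a b c.
Proof.
exists (v 0 0), (v 0 1), (v 0 2%:R); apply/rowP; case=> [[|[|[|//]]] ?];
  by rewrite mxE; congr (v _ _); apply: val_inj.
Qed.

Lemma vec3_inj a b c a' b' c' :
  vec3 a b c = vec3 a' b' c' -> [/\ a = a', b = b' & c = c'].
Proof.
move=> /rowP v; have := (v 0, v 1, v 2%:R); rewrite !mxE /=.
by move=> [[-> ->] ->].
Qed.

Lemma scale_vec3 t a b c : t *: vec3 a b c = vec3 (t * a) (t * b) (t * c).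
Proof. by apply/rowP; case=> [[|[|[|//]]] ?]; rewrite !mxE. Qed.

Lemma add_vec3 a b c a' b' c' :
  vec3 a b c + vec3 a' b' c' = vec3 (a + a') (b + b') (c + c').
Proof. by apply/rowP; case=> [[|[|[|//]]] ?]; rewrite !mxE. Qed.

Lemma vec3_0 : 0 = vec3 0 0 0.
Proof. by apply/rowP; case=> [[|[|[|//]]] ?]; rewrite !mxE. Qed.

Lemma e_vec3 : (e 1 = vec3 1 0 0) * (e 2 = vec3 0 1 0) * (e 3 = vec3 0 0 1).
Proof.
by split; [split|]; apply/rowP; case=> [[|[|[|//]]] ?]; rewrite !mxE.
Qed.

(** Every table is evaluated here in coordinates, so that a later question about products in a
    listed algebra becomes a system of equations in [K]. *)
Lemma mul_vec3 (l : label K) a b c a' b' c' :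
  amul (Malg l) (vec3 a b c) (vec3 a' b' c') =
  match l with
  | M01 => vec3 0 (a * a') 0
  | M02 => vec3 0 0 (a * b' + b * a')
  | M03 => vec3 0 (a * a') (a * b' + b * a')
  | M04 t => vec3 (a * c' + c * a') (t * (b * c' + c * b')) 0
  | M05 => vec3 (a * c' + c * a') (c * c') 0
  | M06 => vec3 (a * c' + c * a') (a * c' + c * a' + (b * c' + c * b')) 0
  | M07 => vec3 (a * c' + c * a' + b * b') 0 0
  end.
Proof.
rewrite /= /table_mul !big_ord_recl !big_ord0 !mxE /=.
by case: l => [||| t|||]; rewrite /table_prod !big_cons !big_nil /=
  !e_vec3 ?addr0 ?vec3_0 ?(add_vec3, scale_vec3); congr vec3; ring.
Qed.

(** Working form of [isomorphic_table]: by commutativity six products determine the table, and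
    [comb i j] is its entry transported to the basis of [A]. *)
Lemma isomorphic_Malg (A : algebra K) (l : label K) (b1 b2 b3 : A) :
    let comb i j := let v := table_prod (table l) i j in
      v 0 0 *: b1 + v 0 1 *: b2 + v 0 2%:R *: b3 in
    commutative_algebra A -> basis_of fullv [:: b1; b2; b3] ->
    amul A b1 b1 = comb 1 1 -> amul A b1 b2 = comb 1 2 ->
    amul A b1 b3 = comb 1 3 -> amul A b2 b2 = comb 2 2 ->
    amul A b2 b3 = comb 2 3 -> amul A b3 b3 = comb 3 3 ->
  isomorphic A (Malg l).
Proof.
move=> comb AC bP e11 e12 e13 e22 e23 e33.
have combC i j : comb i j = comb j i.
  rewrite /comb; suff -> : table_prod (table l) i j = table_prod (table l) j i by [].
  by apply: eq_bigl => p; rewrite orbC.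
apply: (@isomorphic_table _ _ _ [tuple b1; b2; b3]) => // i j.
have -> : \sum_(k < 3) table_prod (table l) i.+1 j.+1 0 k *: [tuple b1; b2; b3]`_k
          = comb i.+1 j.+1.
  rewrite !big_ord_recl big_ord0 addr0 addrA /comb /=.
  by congr (_ *: _ + _ *: _ + _ *: _); congr (table_prod _ _ _ _ _); apply: val_inj.
case: i j => [[|[|[|//]]] ?] [[|[|[|//]]] ?] //=; by rewrite AC combC.
Qed.

End Coordinates.

(** * Linear combinations of three vectors in an abstract algebra *)

Section LinearCombinations.
Variables (K : fieldType) (A : algebra K) (u v w : A).

(** A named constructor lets [congr lincomb] reduce an equality of vectors to three identities
    between scalars, within reach of [ring] and [field]. *)
Definition lincomb a b c : A := a *: u + b *: v + c *: w.

Lemma lincombD a b c a' b' c' :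
  lincomb a b c + lincomb a' b' c' = lincomb (a + a') (b + b') (c + c').
Proof. by rewrite /lincomb !scalerDl addrACA [X in X + _ = _]addrACA. Qed.

Lemma lincombZ t a b c : t *: lincomb a b c = lincomb (t * a) (t * b) (t * c).
Proof. by rewrite /lincomb !scalerDr !scalerA. Qed.

Lemma lincomb0 : 0 = lincomb 0 0 0. Proof. by rewrite /lincomb !scale0r !addr0. Qed.

Lemma lincomb_gen1 : u = lincomb 1 0 0.
Proof. by rewrite /lincomb !scale0r scale1r !addr0. Qed.

Lemma lincomb_gen2 : v = lincomb 0 1 0.
Proof. by rewrite /lincomb !scale0r scale1r addr0 add0r. Qed.

Lemma lincomb_gen3 : w = lincomb 0 0 1.
Proof. by rewrite /lincomb !scale0r scale1r !add0r. Qed.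

Lemma mul_lincomb a b c a' b' c' : commutative_algebra A ->
  amul A (lincomb a b c) (lincomb a' b' c') =
    (a * a') *: amul A u u + (b * b') *: amul A v v + (c * c') *: amul A w w +
    ((a * b' + b * a') *: amul A u v + (a * c' + c * a') *: amul A u w +
     (b * c' + c * b') *: amul A v w).
Proof.
move=> Acomm; rewrite /lincomb !(linearDl, linearDr) !linearZl_LR !linearZr_LR /= !scalerA.
rewrite [amul A w u]Acomm [amul A w v]Acomm [amul A v u]Acomm !scalerDl.
by rewrite (AC (3*3*3) ((1*5*9)*((2*4)*(3*7)*(6*8)))%AC).
Qed.

(** Cramer's rule: the nonzero scalar is the determinant [D] of the change of basis, and the
    cofactors express [D] times each old basis vector through the new ones. The new vectors
    therefore span, and there are three of them. *)
Lemma basis_lincomb a b c a' b' c' a'' b'' c'' :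
    basis_of fullv [:: u; v; w] ->
    a * (b' * c'' - c' * b'') - b * (a' * c'' - c' * a'')
      + c * (a' * b'' - b' * a'') != 0 ->
  basis_of fullv [:: lincomb a b c; lincomb a' b' c'; lincomb a'' b'' c''].
Proof.
move=> bP; set D := (X in X != 0) => D0.
have d3 : \dim {:A} = 3%N by rewrite -(span_basis bP) (eqP (basis_free bP)).
rewrite basisEdim d3 leqnn andbT -(span_basis bP).
set S := (X in (_ <= X)%VS); apply/span_subvP.
have S1 : lincomb a b c \in S by rewrite memv_span ?mem_head.
have S2 : lincomb a' b' c' \in S by rewrite memv_span ?inE ?eqxx ?orbT.
have S3 : lincomb a'' b'' c'' \in S by rewrite memv_span ?inE ?eqxx ?orbT.
have inS p q r x : D *: x =
  p *: lincomb a b c + q *: lincomb a' b' c' + r *: lincomb a'' b'' c'' -> x \in S.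
  move=> Dx; rewrite -[x](scalerK D0) Dx memvZ //.
  by rewrite !rpredD // memvZ.
move=> x; rewrite !inE => /or3P[] /eqP->.
- apply: (inS (b' * c'' - c' * b'') (c * b'' - b * c'') (b * c' - c * b')).
  by rewrite {1}lincomb_gen1 !(lincombZ, lincombD); congr lincomb; rewrite /D; ring.
- apply: (inS (c' * a'' - a' * c'') (a * c'' - c * a'') (c * a' - a * c')).
  by rewrite {1}lincomb_gen2 !(lincombZ, lincombD); congr lincomb; rewrite /D; ring.
apply: (inS (a' * b'' - b' * a'') (b * a'' - a * b'') (a * b' - b * a')).
by rewrite {1}lincomb_gen3 !(lincombZ, lincombD); congr lincomb; rewrite /D; ring.
Qed.

End LinearCombinations.

Lemma lincomb_comp (K : fieldType) (A : algebra K) (u v w : A)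
    a b c a' b' c' a'' b'' c'' x y z :
  lincomb (lincomb u v w a b c) (lincomb u v w a' b' c') (lincomb u v w a'' b'' c'') x y z =
  lincomb u v w (x * a + y * a' + z * a'') (x * b + y * b' + z * b'')
    (x * c + y * c' + z * c'').
Proof. by rewrite {1}/lincomb !(lincombZ, lincombD). Qed.

Ltac table_prod_simp := rewrite /table_prod ?big_cons ?big_nil /= ?mxE /=
  ?(mulr0, mulr1, addr0, scale0r, scale1r, add0r).

(** * Normalization of the basis, one shape of table at a time *)

Section NormalForms.
Variables (K : numClosedFieldType) (A : algebra K) (u v w : A).
Hypotheses (Acomm : commutative_algebra A) (uvw : basis_of fullv [:: u; v; w]).
Local Notation lc := (@lincomb K A u v w).

(** All products are multiples of [v], through the form with matrix diag(1, [b]) on [u], [w]. It has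
    rank one and gives [M01], or it is nondegenerate and gives [M02] in a basis of isotropic
    vectors. *)
Lemma normal_form_nilpotent b :
    amul A u u = lc 0 1 0 -> amul A u v = lc 0 0 0 -> amul A u w = lc 0 0 0 ->
    amul A v v = lc 0 0 0 -> amul A v w = lc 0 0 0 -> amul A w w = lc 0 b 0 ->
  exists l : label K, isomorphic A (Malg l).
Proof.
move=> uu_ uv_ uw_ vv_ vw_ ww_; pose mulE := (uu_, uv_, uw_, vv_, vw_, ww_).
have [b0|b0] := eqVneq b 0.
  exists M01; apply: (@isomorphic_Malg _ _ _ u v w) => //; table_prod_simp;
    by rewrite mulE ?b0 -?lincomb0 -?lincomb_gen2.
(* Since [s ^+ 2 * b = -1], the vectors [u + s w] and [u - s w] square to zero, and their product is
   [2 v]. *)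
pose s := (sqrtC (- b))^-1.
have sb : s ^+ 2 * b = -1 by rewrite exprVn sqrtCK; field; rewrite ?oppr_eq0.
have s0 : s != 0 by rewrite invr_eq0 sqrtC_eq0 oppr_eq0.
exists M02; apply: (@isomorphic_Malg _ _ _ (lc 1 0 s) (lc 1 0 (- s)) (lc 0 2 0)) => //.
  apply: basis_lincomb => //.
  have -> : 1 * (0 * 0 - - s * 2) - 0 * (1 * 0 - - s * 0)
    + s * (1 * 2 - 0 * 0) = 4 * s by ring.
  by rewrite mulf_neq0 ?pnatr_eq0.
all: table_prod_simp; rewrite mul_lincomb // !mulE ?(lincomb0 u v w) !(lincombZ, lincombD).
all: congr lincomb; rewrite ?(mul0r, mulr0, mul1r,mulr1,addr0,add0r) //; try ring: sb.
Qed.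

(** Only the scalar [b] remains to be normalized: zero gives [M04 0], otherwise dividing [v] by a
    square root of [b] gives [M07]. *)
Lemma normal_form_isotropic b :
    amul A u u = lc 0 0 0 -> amul A u v = lc 0 0 0 -> amul A u w = lc 1 0 0 ->
    amul A v v = lc b 0 0 -> amul A v w = lc 0 0 0 -> amul A w w = lc 0 0 0 ->
  exists l : label K, isomorphic A (Malg l).
Proof.
move=> uu_ uv_ uw_ vv_ vw_ ww_; pose mulE := (uu_, uv_, uw_, vv_, vw_, ww_).
have [b0|b0] := eqVneq b 0.
  exists (M04 0); apply: (@isomorphic_Malg _ _ _ u v w) => //; table_prod_simp;
    by rewrite mulE ?b0 ?scale0r -?lincomb0 -?lincomb_gen1.
pose s := (sqrtC b)^-1.
have sb : s ^+ 2 * b = 1 by rewrite exprVn sqrtCK; field.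
have s0 : s != 0 by rewrite invr_eq0 sqrtC_eq0.
exists M07; apply: (@isomorphic_Malg _ _ _ (lc 1 0 0) (lc 0 s 0) (lc 0 0 1)) => //.
  apply: basis_lincomb => //.
  by rewrite !(mul0r, mulr0, mul1r, mulr1, subr0, addr0).
all: table_prod_simp; rewrite mul_lincomb // !mulE ?(lincomb0 u v w) !(lincombZ, lincombD).
all: congr lincomb; rewrite ?(mul0r, mulr0, mul1r,mulr1,addr0,add0r) //; try ring: sb.
Qed.

(** Here [T] has rank one with image spanned by its eigenvector [u]. The second new vector spans the
    kernel of [T]. The third is [w], rescaled to make the eigenvalue 1 and shifted along [u] so that
    its square falls in that kernel; [k] makes this square equal to the second vector. *)
Lemma normal_form_rank1 c d g h :
    amul A u u = lc 0 0 0 -> amul A u v = lc 0 0 0 -> amul A u w = lc c 0 0 ->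
    amul A v v = lc 0 0 0 -> amul A v w = lc d 0 0 -> amul A w w = lc g h 0 ->
    c != 0 -> h != 0 ->
  exists l : label K, isomorphic A (Malg l).
Proof.
move=> uu_ uv_ uw_ vv_ vw_ ww_ c0 h0; pose mulE := (uu_, uv_, uw_, vv_, vw_, ww_).
pose k := h / c ^+ 2; have k0 : k != 0 by rewrite mulf_neq0 ?invr_eq0 ?expf_neq0.
exists M05; apply: (@isomorphic_Malg _ _ _ (lc 1 0 0) (lc (- d / c * k) k 0)
   (lc (- (g + h * d / c) / (2 * c ^+ 2)) 0 c^-1)) => //.
  apply: basis_lincomb => //; rewrite !(mul0r, mulr0, mul1r, mulr1, subr0, addr0).
  by rewrite mulf_neq0 ?invr_eq0.
all: table_prod_simp; rewrite mul_lincomb // !mulE ?(lincomb0 u v w) !(lincombZ, lincombD).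
all: by congr lincomb; rewrite /k; field; rewrite ?c0 ?pnatr_eq0.
Qed.

(** With [T] invertible, [w] can be replaced by a vector of square zero. What is left is the Jordan
    form of [T] up to scaling: diagonal for [M04], a single block for [M06]. *)
Lemma normal_form_rank2 c d f g h :
    amul A u u = lc 0 0 0 -> amul A u v = lc 0 0 0 -> amul A u w = lc c 0 0 ->
    amul A v v = lc 0 0 0 -> amul A v w = lc d f 0 -> amul A w w = lc g h 0 ->
    c != 0 -> f != 0 ->
  exists l : label K, isomorphic A (Malg l).
Proof.
move=> uu_ uv_ uw_ vv_ vw_ ww_ c0 f0; pose mulE := (uu_, uv_, uw_, vv_, vw_, ww_).
(* The vector [x u + y v] solves [T (x u + y v) = (w w) / 2]. As [D D = 0], the square of
   [w - x u - y v] vanishes. *)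
pose y := h / (2 * f); pose x := (g / 2 - d * y) / c.
(* Either [k u + v] is an eigenvector for [f], so that [T] is diagonalizable, or [T] is a Jordan
   block. *)
have [[k kP] | [fc d0]] : (exists k, c * k + d = f * k) \/ f = c /\ d != 0.
  have [fc | fc] := eqVneq f c; last first.
    by left; exists (d / (f - c)); field; rewrite subr_eq0.
  have [-> | d0] := eqVneq d 0; last by right.
  by left; exists 0; rewrite !mulr0 addr0.
{ exists (M04 (f / c)).
  apply: (@isomorphic_Malg _ _ _ (lc 1 0 0) (lc k 1 0) (lc (- x / c) (- y / c) c^-1)) => //.
    apply: basis_lincomb => //; rewrite !(mul0r, mulr0, mul1r, mulr1, subr0, addr0).
    by rewrite invr_eq0.
  all: table_prod_simp; rewrite mul_lincomb // !mulE ?(lincomb0 u v w) !(lincombZ, lincombD).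
  all: congr lincomb; rewrite /x /y; try by field; rewrite ?c0 ?f0 ?pnatr_eq0.
  have -> : d = f * k - c * k by rewrite -kP; ring.
  by field; rewrite ?c0 ?f0 ?pnatr_eq0. }
(* The operator [T / c] sends [v] to [v + (d / c) u], which dictates the first two vectors. *)
subst f; exists M06.
apply: (@isomorphic_Malg _ _ _ (lc 0 1 0) (lc (d / c) 0 0) (lc (- x / c) (- y / c) c^-1)) => //.
  apply: basis_lincomb => //; rewrite !(mul0r, mulr0, mul1r, mulr1, subr0, addr0, sub0r).
  by rewrite oppr_eq0 !mulf_neq0 ?invr_eq0.
all: table_prod_simp; rewrite mul_lincomb // !mulE ?(lincomb0 u v w) !(lincombZ, lincombD).
all: congr lincomb; rewrite /x /y; by field; rewrite ?c0 ?pnatr_eq0.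
Qed.

(** The element [w] generates the algebra: the new basis is [w], [w w], [w (w w)]. *)
Lemma normal_form_nilpotent_operator d g h :
    amul A u u = lc 0 0 0 -> amul A u v = lc 0 0 0 -> amul A u w = lc 0 0 0 ->
    amul A v v = lc 0 0 0 -> amul A v w = lc d 0 0 -> amul A w w = lc g h 0 ->
    d != 0 -> h != 0 ->
  exists l : label K, isomorphic A (Malg l).
Proof.
move=> uu_ uv_ uw_ vv_ vw_ ww_ d0 h0; pose mulE := (uu_, uv_, uw_, vv_, vw_, ww_).
exists M03.
apply: (@isomorphic_Malg _ _ _ (lc 0 0 1) (lc g h 0) (lc (h * d) 0 0)) => //.
  apply: basis_lincomb => //; rewrite !(mul0r, mulr0, mul1r, mulr1, subr0, oppr0, addr0, add0r, sub0r).
  by rewrite oppr_eq0 !mulf_neq0.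
all: table_prod_simp; rewrite mul_lincomb // !mulE ?(lincomb0 u v w) !(lincombZ, lincombD).
all: by congr lincomb; ring.
Qed.

End NormalForms.

(** * Triangularization of the operator on the derived plane *)

Section Operator.
Variables (K : numClosedFieldType) (A : algebra K).
Hypothesis Acomm : commutative_algebra A.

(* (c, 0), (d, f), (g, h) are the coordinates of the generators u w, v w, w w of the
   derived algebra; the last hypothesis says that they span a plane. *)
Lemma normal_form_triangular (u v w : A) c d f g h :
    basis_of fullv [:: u; v; w] ->
    amul A u u = lincomb u v w 0 0 0 -> amul A u v = lincomb u v w 0 0 0 ->
    amul A u w = lincomb u v w c 0 0 -> amul A v v = lincomb u v w 0 0 0 ->
    amul A v w = lincomb u v w d f 0 -> amul A w w = lincomb u v w g h 0 ->
    [|| c * f != 0, c * h != 0 | d * h - f * g != 0] ->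
  exists l : label K, isomorphic A (Malg l).
Proof.
move=> uvw uu_ uv_ uw_ vv_ vw_ ww_.
have [c0 | c0] := eqVneq c 0; have [f0 | f0] := eqVneq f 0.
- rewrite c0 f0 !mul0r eqxx subr0 mulf_eq0 negb_or => /andP[d0 h0].
  rewrite c0 f0 in uw_ vw_.
  exact: (normal_form_nilpotent_operator _ uvw uu_ uv_ uw_ vv_ vw_ ww_).
- rewrite c0 !mul0r eqxx /= => n0; rewrite c0 in uw_.
  pose mulE := (uu_, uv_, uw_, vv_, vw_, ww_).
  (* The eigenvector of [T] for [f] is [(d / f) u + v]. Placing it before the kernel vector [u]
     gives the shape of [normal_form_rank1]. *)
  have := @normal_form_rank1 _ _ (lincomb u v w (d / f) 1 0) (lincomb u v w 1 0 0)
            (lincomb u v w 0 0 1)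
            Acomm _ f 0 h (g - h * d / f); apply => //.
    apply: basis_lincomb => //.
    by rewrite !(mul0r, mulr0, mul1r, mulr1, subr0, oppr0, addr0, add0r, sub0r)
      oppr_eq0 oner_eq0.
  1-6: by rewrite mul_lincomb // !mulE lincomb_comp !(lincombZ, lincombD); congr lincomb; field.
  apply: contra_neq n0 => n0.
  by rewrite -[g](subrK (h * d / f)) n0; field.
- rewrite f0 in vw_; rewrite f0 mulr0 mul0r eqxx subr0 !mulf_eq0 !negb_or /= => n0.
  apply: (normal_form_rank1 Acomm uvw uu_ uv_ uw_ vv_ vw_ ww_ c0).
  by case/orP: n0 => /andP[].
by move=> _; apply: (normal_form_rank2 Acomm uvw uu_ uv_ uw_ vv_ vw_ ww_).
Qed.

(** The disjunction lists the 2 by 2 minors of the coordinates of [u w], [v w], [w w]; one being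
    nonzero says that these products span a plane. An eigenvector of [T] taken as first basis vector
    reduces to the triangular case. *)
Lemma normal_form_operator (u v w : A) a b c d g h :
    basis_of fullv [:: u; v; w] ->
    amul A u u = lincomb u v w 0 0 0 -> amul A u v = lincomb u v w 0 0 0 ->
    amul A u w = lincomb u v w a b 0 -> amul A v v = lincomb u v w 0 0 0 ->
    amul A v w = lincomb u v w c d 0 -> amul A w w = lincomb u v w g h 0 ->
    [|| a * d - b * c != 0, a * h - b * g != 0 | c * h - d * g != 0] ->
  exists l : label K, isomorphic A (Malg l).
Proof.
move=> uvw uu_ uv_ uw_ vv_ vw_ ww_; have [b0 | b0] := eqVneq b 0.
  rewrite b0 in uw_; rewrite b0 !mul0r !subr0 => n0.
  exact: (normal_form_triangular uvw uu_ uv_ uw_ vv_ vw_ ww_).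
move=> n0; pose mulE := (uu_, uv_, uw_, vv_, vw_, ww_).
(* [x u + v] is an eigenvector of the multiplication by [w] when [x] is a root of
   [b X^2 + (d - a) X - c]. *)
pose s := sqrtC ((d - a) ^+ 2 + 4 * b * c); pose x := (a - d + s) / (2 * b).
have xP : b * x ^+ 2 = (a - d) * x + c.
  have sE : s ^+ 2 = (d - a) ^+ 2 + 4 * b * c by rewrite sqrtCK.
  by rewrite /x; field: sE; rewrite ?b0 ?pnatr_eq0.
have := @normal_form_triangular (lincomb u v w x 1 0) (lincomb u v w 1 0 0)
          (lincomb u v w 0 0 1)
          (b * x + d) b (a - b * x) h (g - x * h); apply => //.
  apply: basis_lincomb => //.
  by rewrite !(mul0r, mulr0, mul1r, mulr1, subr0, oppr0, addr0, add0r, sub0r)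
      oppr_eq0 oner_eq0.
1-6: by rewrite mul_lincomb // !mulE lincomb_comp !(lincombZ, lincombD); congr lincomb;
  ring: xP.
(* The old minors are combinations of the new ones, so they cannot all vanish in the new basis. *)
apply: contraT; rewrite !negb_or !negbK => /and3P[/eqP e1 /eqP e2 /eqP e3].
have E1 : a * d - b * c = 0 by rewrite -e1; ring: xP.
have E2 : a * h - b * g = 0 by rewrite -[RHS]oppr0 -e3; ring.
have E3 : c * h - d * g = - x * (a * h - b * g) - (b * x + d) * (g - x * h).
  by ring: xP.
rewrite E2 e2 mulr0 subr0 in E3.
by move: n0; rewrite E1 E2 E3 eqxx.
Qed.

End Operator.

(** * The derived space and completion of bases *)

Section DerivedAlgebra.
Variables (K : fieldType) (A : algebra K).

Definition derived_space : {vspace A} :=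
  <<[seq amul A x y | x <- vbasis {:A}, y <- vbasis {:A}]>>%VS.

(** By bilinearity the products of basis vectors suffice: [derived_space] is the least subspace
    containing all products. *)
Lemma derived_space_subvP (V : {vspace A}) :
  reflect (forall x y, amul A x y \in V) (derived_space <= V)%VS.
Proof.
apply: (iffP span_subvP) => [DV x y | DV _ /allpairsP[[x y] [_ _ ->]] //].
rewrite (coord_vbasis (memvf x)) (coord_vbasis (memvf y)).
rewrite linear_sumlz rpred_sum // => i _; rewrite linear_sumr rpred_sum // => j _.
rewrite linearZl_LR linearZr_LR !memvZ // DV //.
by apply: allpairs_f; rewrite mem_nth // size_tuple.
Qed.

Lemma mem_derived_space x y : amul A x y \in derived_space.
Proof. exact: (derived_space_subvP _ (subvv _)). Qed.

Lemma metabelian_derived_space : commutative_algebra A -> metabelian_algebra A ->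
  {in derived_space &, forall x y, amul A x y = 0}.
Proof.
move=> Acomm Ameta x y xD yD.
have DP z : (forall t s, amul A z (amul A t s) = 0) ->
    forall t, t \in derived_space -> amul A z t = 0.
  (* The kernel of multiplication by [z] is a subspace; if it contains all products, it contains the
     derived space. This is used once for each factor. *)
  move=> zP t; have /subvP DV : (derived_space <= lker (linfun (amul A z)))%VS.
    by apply/derived_space_subvP => ? ?; rewrite memv_ker lfunE /= zP.
  by move=> /DV; rewrite memv_ker lfunE => /eqP.
by apply: (DP x) => // t s; rewrite Acomm; apply: DP => // *; apply: Ameta.
Qed.

Lemma basis3P (u v w : A) : basis_of fullv [:: u; v; w] ->
  forall x, exists a b c, x = lincomb u v w a b c.
Proof.
move=> uvw x.
have := @coord_basis _ _ fullv 3 [tuple u; v; w] x uvw (memvf x).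
rewrite !big_ord_recl big_ord0 addr0 addrA /= => ->.
by do 3!eexists.
Qed.

Lemma derived_space_basis (u v w : A) (V : {vspace A}) :
    commutative_algebra A -> basis_of fullv [:: u; v; w] ->
    amul A u u \in V -> amul A u v \in V -> amul A u w \in V ->
    amul A v v \in V -> amul A v w \in V -> amul A w w \in V ->
  (derived_space <= V)%VS.
Proof.
move=> Acomm uvw ? ? ? ? ? ?; apply/derived_space_subvP => x y.
have [a [b [c ->]]] := basis3P uvw x; have [a' [b' [c' ->]]] := basis3P uvw y.
by rewrite mul_lincomb // !rpredD ?memvZ.
Qed.

Lemma basis3 (u v w : A) : \dim {:A} = 3%N ->
  u != 0 -> v \notin <[u]>%VS -> w \notin <<[:: v; u]>>%VS ->
  basis_of fullv [:: u; v; w].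
Proof.
move=> d3 u0 vu wvu; have p : perm_eq [:: u; v; w] [:: w; v; u].
  by rewrite -(perm_rev [:: u; v; w]).
by rewrite basisEfree subvf d3 andbT (perm_free p) !free_cons wvu span_seq1 vu
  span_nil memv0 u0 nil_free.
Qed.

Lemma exists_notin_span (s : seq A) : (size s < \dim {:A})%N ->
  exists x, x \notin <<s>>%VS.
Proof.
move=> sA; have /subvPn[x _ xs] : ~~ (fullv <= <<s>>)%VS; last by exists x.
by apply: contraL sA => /dimvS; rewrite -leqNgt => /leq_trans; apply; apply: dim_span.
Qed.

End DerivedAlgebra.

(** * Case analysis on the dimension of the derived space *)

Section Classification.
Variables (K : numClosedFieldType) (A : algebra K).
Hypotheses (d3 : \dim {:A} = 3%N) (Acomm : commutative_algebra A).

Lemma span2P (u v x : A) : x \in <<[:: v; u]>>%VS -> exists a b, x = a *: u + b *: v.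
Proof.
rewrite span_cons span_seq1 => /memv_addP[y /vlineP[b ->] [z /vlineP[a ->] ->]].
by exists a, b; rewrite addrC.
Qed.

(** The line [D] lies in the radical of the form [B]. A non-isotropic [x] exists, and a third vector
    is made orthogonal to it, so that [B] becomes diagonal. *)
Lemma derived_line_annihilated (v : A) : v != 0 -> ~ zero_algebra A ->
    (forall x y, exists k, amul A x y = k *: v) -> (forall x, amul A v x = 0) ->
  exists l : label K, isomorphic A (Malg l).
Proof.
move=> v0 An0 AP vA.
have [x xx0] : exists x, amul A x x != 0.
  (* Polarization: if all squares vanish, then [2 x y = 0] for all [x], [y]. *)
  apply: contrapT => sq0; apply: An0 => x y.
  have sq z : amul A z z = 0 by apply/eqP/negPn/negP => zz0; apply: sq0; exists z.
  have := sq (x + y); rewrite linearDl !linearDr /= !sq addr0 add0r [amul A y x]Acomm.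
  by rewrite -mulr2n -scaler_nat => /eqP; rewrite scaler_eq0 pnatr_eq0 => /eqP.
have [m mP] := AP x x; have m0 : m != 0 by apply: contraNneq xx0 => m0; rewrite mP m0 scale0r.
pose u := amul A x x.
have uA y : amul A u y = 0 by rewrite /u mP linearZl_LR /= vA scaler0.
have AP' y z : exists k, amul A y z = k *: u.
  have [k ->] := AP y z; exists (k / m); rewrite /u mP scalerA; congr (_ *: _).
  by field.
(* As [u] annihilates [x], an equality [u = k x] would give [k u = 0], hence [u = 0]. *)
have ux : u \notin <[x]>%VS.
  apply: contraNN xx0 => /vlineP[k kE]; have := uA x; rewrite kE linearZl_LR /= -/u.
  by move=> /eqP; rewrite scaler_eq0 => /orP[/eqP k0 | //]; rewrite -/u kE k0 scale0r.
have x0 : x != 0 by apply: contraNneq xx0 => ->; rewrite linear0l.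
have [y yP] : exists y, y \notin <<[:: u; x]>>%VS by apply: exists_notin_span; rewrite d3.
have [k kE] := AP' x y.
have [b bE] := AP' (y - k *: x) (y - k *: x).
have xuy : basis_of fullv [:: x; u; y - k *: x].
  apply: basis3 => //; apply: contraNN yP => yP.
  rewrite -[y](subrK (k *: x)) rpredD // memvZ // memv_span //.
  by rewrite !inE eqxx orbT.
apply: (normal_form_nilpotent (b := b) Acomm xuy).
all: rewrite -?lincomb0 -?lincomb_gen2 ?uA // ?[amul A x u]Acomm ?uA //.
  by rewrite linearBr linearZr_LR /= kE subrr.
by rewrite bE /lincomb !scale0r addr0 add0r.
Qed.

(** The isotropic vector [v] lies outside the radical of [B], so it extends to a hyperbolic pair
    [v], [w]; a third vector is then made orthogonal to both. *)
Lemma derived_line_not_annihilated (v t : A) :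
    (forall x y, exists k, amul A x y = k *: v) -> amul A v v = 0 -> amul A v t != 0 ->
  exists l : label K, isomorphic A (Malg l).
Proof.
move=> AP vv vt0; have [k kE] := AP v t.
have k0 : k != 0 by apply: contraNneq vt0 => k0; rewrite kE k0 scale0r.
have v0 : v != 0 by apply: contraNneq vt0 => ->; rewrite linear0l.
have [s vs] : exists s, amul A v s = v.
  by exists (k^-1 *: t); rewrite linearZr_LR /= kE scalerA mulVf ?scale1r.
(* The shift by [(m / 2) v] cancels the square of [s] and keeps [v w = v]. *)
have [m mE] := AP s s; pose w := s - (m / 2) *: v.
have vw : amul A v w = v by rewrite linearBr linearZr_LR /= vv scaler0 subr0.
have ww : amul A w w = 0.
  rewrite {1}/w linearBl linearZl_LR /= vw Acomm linearBl linearZl_LR /= vs mE -!scalerBl.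
  by rewrite [X in X *: _](_ : _ = 0) ?scale0r //; field; rewrite ?pnatr_eq0.
have wv : w \notin <[v]>%VS.
  apply: contraNN v0 => /vlineP[c cE].
  by rewrite -vw cE linearZr_LR /= vv scaler0.
have [x xP] : exists x, x \notin <<[:: w; v]>>%VS by apply: exists_notin_span; rewrite d3.
have [c cE] := AP x w; have [d dE] := AP x v.
pose y := x - c *: v - d *: w.
have yv : amul A v y = 0.
  by rewrite !linearBr !linearZr_LR /= vv scaler0 subr0 vw Acomm dE subrr.
have yw : amul A y w = 0.
  by rewrite !linearBl !linearZl_LR /= ww scaler0 subr0 vw cE subrr.
have [b bE] := AP y y.
have vyw : basis_of fullv [:: v; y; w].
  have p : perm_eq [:: v; w; y] [:: v; y; w].
    by rewrite perm_cons (perm_catC [:: w] [:: y]).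
  rewrite -(perm_basis fullv p); apply: basis3 => //; apply: contraNN xP => yP.
  rewrite -[x](subrK (c *: v)) rpredD //; last first.
    by rewrite memvZ // memv_span // !inE eqxx orbT.
  rewrite -[_ - _](subrK (d *: w)) rpredD // memvZ // memv_span //.
  by rewrite !inE eqxx.
apply: (normal_form_isotropic (b := b) Acomm vyw); rewrite -?lincomb0 -?lincomb_gen1 //.
by rewrite bE /lincomb !scale0r !addr0.
Qed.

Lemma derived_plane : metabelian_algebra A -> \dim (derived_space A) = 2%N ->
  exists l : label K, isomorphic A (Malg l).
Proof.
move=> Ameta; set D := derived_space A => D2.
have [v [u uvP]] : exists v u, basis_of D [:: v; u].
  have [s [s2 sP]] : exists s : seq A, size s = 2%N /\ basis_of D s.
    by exists (vbasis D); rewrite size_tuple vbasisP.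
  by case: s s2 sP => [|v [|u []]] // _ ?; exists v, u.
have DE := span_basis uvP; have /andP[vu u0] : (v \notin <[u]>%VS) && (u != 0).
  by have := basis_free uvP; rewrite free_cons span_seq1 seq1_free.
have [w wD] : exists w, w \notin <<[:: v; u]>>%VS by apply: exists_notin_span; rewrite d3.
have uvw := basis3 d3 u0 vu wD.
have uD : u \in D by rewrite -DE memv_span // !inE eqxx orbT.
have vD : v \in D by rewrite -DE memv_span // !inE eqxx.
have DP x y : exists a b, amul A x y = lincomb u v w a b 0.
  have : amul A x y \in <<[:: v; u]>>%VS by rewrite DE mem_derived_space.
  by move=> /span2P[a [b ->]]; exists a, b; rewrite /lincomb scale0r addr0.
have DD := metabelian_derived_space Acomm Ameta.
have [a [b uw]] := DP u w; have [c [d vw]] := DP v w; have [g [h ww]] := DP w w.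
have uu : amul A u u = 0 by apply: DD.
have uv : amul A u v = 0 by apply: DD.
have vv : amul A v v = 0 by apply: DD.
apply: (@normal_form_operator _ _ Acomm u v w a b c d g h) => //; rewrite -?lincomb0 //.
(* If all minors vanished, [u w], [v w] and [w w] would lie on the line of the first nonzero one
   among them, against [\dim D = 2]. *)
apply: contraT; rewrite !negb_or !negbK !subr_eq0 => /and3P[/eqP e1 /eqP e2 /eqP e3].
have small x : amul A u w \in <[x]>%VS -> amul A v w \in <[x]>%VS ->
    amul A w w \in <[x]>%VS -> false.
  move=> ux vx wx; have : (D <= <[x]>)%VS.
    by apply: (derived_space_basis Acomm uvw); rewrite // ?uu ?uv ?vv mem0v.
  by move=> /dimvS; rewrite D2 dim_vline; case: (x != 0).
have prop x a' b' a'' b'' : x = lincomb u v w a' b' 0 -> (a' != 0) || (b' != 0) ->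
    a' * b'' = b' * a'' -> lincomb u v w a'' b'' 0 \in <[x]>%VS.
  move=> -> /orP[n0 | n0] E; apply/vlineP.
    exists (a'' / a'); rewrite lincombZ; congr lincomb; [by field | | by rewrite mulr0].
    by rewrite mulrAC -[LHS](mulKf n0) E; field.
  exists (b'' / b'); rewrite lincombZ; congr lincomb; [| by field | by rewrite mulr0].
  by rewrite mulrAC -[LHS](mulKf n0) -E; field.
have [ab0 | ab0] := boolP ((a != 0) || (b != 0)).
  apply: (small (amul A u w)); first exact: memv_line.
    by rewrite {1}vw; apply: prop uw ab0 _.
  by rewrite {1}ww; apply: prop uw ab0 _.
move: ab0; rewrite negb_or !negbK => /andP[/eqP a0 /eqP b0].
have uw0 : amul A u w = 0 by rewrite uw a0 b0 -lincomb0.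
have [cd0 | cd0] := boolP ((c != 0) || (d != 0)).
  apply: (small (amul A v w)); rewrite ?uw0 ?mem0v ?memv_line //.
  by rewrite {1}ww; apply: prop vw cd0 _.
move: cd0; rewrite negb_or !negbK => /andP[/eqP c0 /eqP d0].
have vw0 : amul A v w = 0 by rewrite vw c0 d0 -lincomb0.
by apply: (small (amul A w w)); rewrite ?uw0 ?vw0 ?mem0v ?memv_line.
Qed.

Theorem classification : metabelian_algebra A -> ~ zero_algebra A ->
  exists l : label K, isomorphic A (Malg l).
Proof.
move=> Ameta An0; set D := derived_space A.
have DP x y : amul A x y \in D := mem_derived_space x y.
have : (\dim D <= 3)%N by rewrite -d3 dimvS ?subvf.
rewrite leq_eqVlt ltnS leq_eqVlt ltnS leq_eqVlt ltnS leqn0.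
case/or4P => [/eqP D3 | /eqP D2 | /eqP D1 | D0].
(* If [D] is the whole algebra, [D D = 0] makes every product vanish. *)
- have DE : D = fullv by apply/eqP; rewrite eqEdim subvf D3 d3.
  by case: An0 => x y; apply: (metabelian_derived_space Acomm Ameta); rewrite -/D DE memvf.
- exact: derived_plane.
- pose v := vpick D; have v0 : v != 0 by rewrite vpick0 -dimv_eq0 D1.
  have vD : v \in D by apply: memv_pick.
  have DE : D = <[v]>%VS by apply/eqP; rewrite eq_sym eqEdim dim_vline v0 D1 -memvE vD.
  have AP x y : exists k, amul A x y = k *: v by apply/vlineP; rewrite -DE.
  have vv : amul A v v = 0 by apply: (metabelian_derived_space Acomm Ameta).
  have [[t vt] | vA] := pselect (exists t, amul A v t != 0).
    exact: derived_line_not_annihilated AP vv vt.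
  apply: derived_line_annihilated v0 An0 AP _ => x.
  by apply/eqP/negPn/negP => vx; apply: vA; exists x.
case: An0 => x y; have := DP x y.
by move: D0; rewrite dimv_eq0 => /eqP->; rewrite memv0 => /eqP.
Qed.

End Classification.

(** * Invariants of isomorphism and their values on the list *)

Section Invariants.
Variable K : fieldType.
Implicit Types (A B : algebra K) (l : label K).

(** This property separates [M01] from [M02], which agree on associativity, annihilators and
    [products_in_line]. *)
Definition isotropic_product_zero A :=
  forall x y : A, amul A x x = 0 -> amul A y y = 0 -> amul A x y = 0.

Definition has_annihilator A := exists2 x : A, x != 0 & forall y, amul A x y = 0.

Definition products_in_line A := exists v : A, forall x y, exists k, amul A x y = k *: v.

(** Rescaling [x] normalizes one nonzero eigenvalue to 1, so [alpha] stands for a ratio of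
    eigenvalues; exchanging the eigenvectors inverts it. *)
Definition has_eigenvalues A alpha := exists x y z : A,
  [/\ forall a b, a *: y + b *: z = 0 -> a = 0 /\ b = 0,
      amul A x y = y & amul A x z = alpha *: z].

Lemma isomorphic_associative A B :
  isomorphic A B -> associative_algebra A -> associative_algebra B.
Proof.
move=> [f [[g fK gK] fM]] P x y z.
by rewrite -[x]gK -[y]gK -[z]gK -!fM P.
Qed.

Lemma isomorphic_isotropic_product_zero A B :
  isomorphic A B -> isotropic_product_zero A -> isotropic_product_zero B.
Proof.
move=> [f [[g fK gK] fM]] P x y; rewrite -[x]gK -[y]gK -!fM -!(raddf0 f).
by move=> /(can_inj fK) xx /(can_inj fK) yy; rewrite P.
Qed.

Lemma isomorphic_has_annihilator A B :
  isomorphic A B -> has_annihilator A -> has_annihilator B.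
Proof.
move=> [f [[g fK gK] fM]] [x x0 xA]; exists (f x).
  by rewrite -(raddf0 f) (inj_eq (can_inj fK)).
by move=> y; rewrite -[y]gK -fM xA raddf0.
Qed.

Lemma isomorphic_products_in_line A B :
  isomorphic A B -> products_in_line A -> products_in_line B.
Proof.
move=> [f [[g fK gK] fM]] [v P]; exists (f v) => x y.
have [k kE] := P (g x) (g y); exists k.
by rewrite -[x]gK -[y]gK -fM kE linearZ.
Qed.

Lemma isomorphic_has_eigenvalues A B alpha :
  isomorphic A B -> has_eigenvalues A alpha -> has_eigenvalues B alpha.
Proof.
move=> [f [[g fK gK] fM]] [x [y [z [yz xy xz]]]].
exists (f x), (f y), (f z); split; [|by rewrite -fM xy | by rewrite -fM xz linearZ].
move=> a b; rewrite -!linearZ -linearD -(raddf0 f) => /(can_inj fK); exact: yz.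
Qed.

Lemma associative_Malg l : associative_algebra (Malg l) <->
  match l with M01 | M02 | M03 => True | _ => False end.
Proof.
have ev : associative_algebra (Malg l) <-> forall x1 x2 x3 y1 y2 y3 z1 z2 z3,
   amul (Malg l) (vec3 x1 x2 x3) (amul (Malg l) (vec3 y1 y2 y3) (vec3 z1 z2 z3)) =
   amul (Malg l) (amul (Malg l) (vec3 x1 x2 x3) (vec3 y1 y2 y3)) (vec3 z1 z2 z3).
  split=> [P * | P x y z]; first exact: P.
  have [? [? [? ->]]] := vec3_eta x; have [? [? [? ->]]] := vec3_eta y.
  by have [? [? [? ->]]] := vec3_eta z; apply: P.
rewrite ev {ev}; case: l => [|||t|||]; split=> // P.
1-3: by move=> *; rewrite !mul_vec3; congr vec3; ring.
(* The triple [e 1], [e 3], [e 3] breaks associativity: the first coordinate is 0 for [e1 (e3 e3)]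
   and 1 for [(e1 e3) e3]. *)
all: by have := P 1 0 0 0 0 1 0 0 1; rewrite !mul_vec3 => /vec3_inj[/eqP+ _ _];
  rewrite ?(mulr0, mul0r, mulr1, mul1r, addr0, add0r) ?eqxx eq_sym oner_eq0.
Qed.

Lemma isotropic_product_zero_M01 : isotropic_product_zero (Malg (@M01 K)).
Proof.
move=> x y; have [a [b [c ->]]] := vec3_eta x; have [a' [b' [c' ->]]] := vec3_eta y.
rewrite !mul_vec3 vec3_0 => /vec3_inj[_ /eqP + _] _.
by rewrite mulf_eq0 orbb => /eqP->; rewrite mul0r.
Qed.

Lemma isotropic_product_zero_M02 : ~ isotropic_product_zero (Malg (@M02 K)).
Proof.
move=> P; have := P (vec3 1 0 0) (vec3 0 1 0); rewrite !mul_vec3 vec3_0.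
rewrite ?(mulr0, mul0r, mulr1, mul1r, addr0, add0r) => /(_ erefl erefl) /vec3_inj[_ _ /eqP].
by rewrite oner_eq0.
Qed.

Lemma has_annihilator_Malg l : has_annihilator (Malg l) <->
  match l with M04 alpha => alpha = 0 | M06 | M07 => False | _ => True end.
Proof.
have ann a b c : [|| a != 0, b != 0 | c != 0] ->
    (forall a' b' c', amul (Malg l) (vec3 a b c) (vec3 a' b' c') = 0) ->
    has_annihilator (Malg l).
  move=> abc P; exists (vec3 a b c) => [|y]; last first.
    by have [a' [b' [c' ->]]] := vec3_eta y; apply: P.
  apply: contraTneq abc; rewrite vec3_0 => /vec3_inj[-> -> ->].
  by rewrite eqxx.
split=> [[x + xA] | ].
  have [a [b [c xE]]] := vec3_eta x; subst x.
  have := (xA (vec3 1 0 0), xA (vec3 0 1 0), xA (vec3 0 0 1)).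
  case: l {ann} xA => [|||t|||] // _; rewrite !mul_vec3 vec3_0
    ?(mulr0, mul0r, mulr1, mul1r, addr0, add0r).
  - move=> [[/vec3_inj[c0 _ _] /vec3_inj[_ tc _]] /vec3_inj[a0 /eqP tb _]].
    rewrite c0 a0; apply: contraNeq => t0; move: tb.
    by rewrite mulf_eq0 (negPf t0) => /eqP->.
  - move=> [[/vec3_inj[c0 _ _] _] /vec3_inj[a0 b0 _]].
    by rewrite c0 a0 add0r in b0 *; rewrite b0 eqxx.
  by move=> [[/vec3_inj[-> _ _] /vec3_inj[-> _ _]] /vec3_inj[-> _ _]]; rewrite eqxx.
have one := oner_neq0 K.
case: l ann => [|||t|||] // ann lE; [apply: (ann 0 1 0) | apply: (ann 0 0 1) |
  apply: (ann 0 0 1) | apply: (ann 0 1 0) | apply: (ann 0 1 0)];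
  rewrite ?one ?orbT // => *; rewrite mul_vec3 vec3_0 ?lE; congr vec3; ring.
Qed.

(** Gives the obstruction used below: two linearly independent products exclude a common line. *)
Lemma products_in_line_dep A : products_in_line A -> forall x y z t,
  exists a b, (a != 0) || (b != 0) /\ a *: amul A x y = b *: amul A z t.
Proof.
move=> [v P] x y z t; have [a ->] := P x y; have [b ->] := P z t.
have [a0 | a0] := eqVneq a 0.
  by exists 1, 0; rewrite oner_neq0 a0 !scale0r scaler0.
by exists b, a; rewrite a0 orbT !scalerA mulrC.
Qed.

Lemma products_in_line_Malg l : products_in_line (Malg l) <->
  match l with M04 alpha => alpha = 0 | M03 | M05 | M06 => False | _ => True end.
Proof.
have no x y z t :
    (forall a b, a *: amul (Malg l) x y = b *: amul (Malg l) z t -> a = 0 /\ b = 0) ->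
   ~ products_in_line (Malg l).
  by move=> P /products_in_line_dep/(_ x y z t)[a [b [ab /P[a0 b0]]]]; rewrite a0 b0 eqxx in ab.
have yes v : (forall a b c a' b' c', exists k,
     amul (Malg l) (vec3 a b c) (vec3 a' b' c') = k *: v) -> products_in_line (Malg l).
  move=> P; exists v => x y; have [? [? [? ->]]] := vec3_eta x.
  by have [? [? [? ->]]] := vec3_eta y; apply: P.
pose simp := (mulr0, mul0r, mulr1, mul1r, addr0, add0r).
case: l no yes => [|||s|||] no yes; split=> //.
- move=> _; apply: (yes (vec3 0 1 0)) => a b c a' b' c'; exists (a * a').
  by rewrite mul_vec3 scale_vec3 ?simp.
- move=> _; apply: (yes (vec3 0 0 1)) => a b c a' b' c'; exists (a * b' + b * a').
  by rewrite mul_vec3 scale_vec3 ?simp.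
- apply: (no (vec3 1 0 0) (vec3 1 0 0) (vec3 1 0 0) (vec3 0 1 0)) => a b.
  by rewrite !mul_vec3 !scale_vec3 ?simp => /vec3_inj[_ -> ->].
- move=> P; apply/eqP; apply: contraPT P => s0.
  apply: (no (vec3 1 0 0) (vec3 0 0 1) (vec3 0 1 0) (vec3 0 0 1)) => a b.
  rewrite !mul_vec3 !scale_vec3 ?simp => /vec3_inj[-> /esym/eqP + _].
  by rewrite mulf_eq0 (negPf s0) orbF => /eqP.
- move=> s0; apply: (yes (vec3 1 0 0)) => a b c a' b' c'; exists (a * c' + c * a').
  by rewrite mul_vec3 scale_vec3 s0 ?simp.
- apply: (no (vec3 1 0 0) (vec3 0 0 1) (vec3 0 0 1) (vec3 0 0 1)) => a b.
  by rewrite !mul_vec3 !scale_vec3 ?simp => /vec3_inj[-> ->].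
- apply: (no (vec3 1 0 0) (vec3 0 0 1) (vec3 0 1 0) (vec3 0 0 1)) => a b.
  by rewrite !mul_vec3 !scale_vec3 ?simp => /vec3_inj[-> <-].
move=> _; apply: (yes (vec3 1 0 0)) => a b c a' b' c'; exists (a * c' + c * a' + b * b').
by rewrite mul_vec3 scale_vec3 ?simp.
Qed.

End Invariants.

(** * Eigenvalues and separation of the listed algebras *)

Section Eigenvalues.
Variable K : fieldType.
Implicit Types (l : label K) (alpha : K).

Lemma has_eigenvalues_M04 alpha : has_eigenvalues (Malg (M04 alpha)) alpha.
Proof.
exists (vec3 0 0 1), (vec3 1 0 0), (vec3 0 1 0); split=> [a b||].
- rewrite !scale_vec3 add_vec3 vec3_0 !(mulr0, mulr1, addr0, add0r).
  by move=> /vec3_inj[-> ->].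
- by rewrite mul_vec3; congr vec3; ring.
by rewrite mul_vec3 scale_vec3; congr vec3; ring.
Qed.

Lemma has_eigenvalues_Malg l alpha : alpha != 0 -> has_eigenvalues (Malg l) alpha ->
  l = M04 alpha \/ l = M04 alpha^-1.
Proof.
move=> alpha0 [x [y [z [yz + +]]]].
have [p [q [r xE]]] := vec3_eta x; have [a [b [c yE]]] := vec3_eta y.
have [a' [b' [c' zE]]] := vec3_eta z; subst x y z.
have y0 : ~ [/\ a = 0, b = 0 & c = 0].
  case=> a0 b0 c0; have := yz 1 0; rewrite a0 b0 c0 -vec3_0 scaler0 scale0r addr0.
  by case=> // /eqP; rewrite oner_eq0.
(* Independence of the two eigenvectors, read in the plane of the first two coordinates. *)
have minor0 : c = 0 -> c' = 0 -> a * b' != b * a'.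
  move=> c0 c'0; apply/negP => /eqP abE; apply: y0.
  have [b'0 b0] : b' = 0 /\ - b = 0.
    apply: yz; rewrite !scale_vec3 add_vec3 c0 c'0 vec3_0; congr vec3; try ring.
    by rewrite mulrC abE; ring.
  have [_ a0] : a' = 0 /\ - a = 0.
    apply: yz; rewrite !scale_vec3 add_vec3 c0 c'0 vec3_0; congr vec3; try ring.
    by rewrite b'0 -[b]opprK b0; ring.
  by split=> //; apply: oppr_inj; rewrite oppr0.
have kills s : alpha * s = 0 -> s = 0.
  by move=> /eqP; rewrite mulf_eq0 (negPf alpha0) => /eqP.
rewrite !mul_vec3 scale_vec3; case: l {yz} => [|||beta|||] /vec3_inj[].
- by move=> a0 /esym b0 c0 _; case: y0; rewrite b0 -a0 mulr0 -c0.
- by move=> a0 b0 /esym c0 _; case: y0; rewrite c0 -a0 -b0 !mulr0 addr0.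
- move=> a0 /esym b0 /esym c0 _; case: y0; rewrite -a0 mulr0 in b0 c0 *.
  by rewrite c0 b0 !mulr0 addr0.
- move=> e1 e2 /esym c0 /vec3_inj[e3 e4 /esym/kills c'0].
  rewrite c0 mulr0 add0r in e1; rewrite c0 mulr0 add0r in e2.
  rewrite c'0 mulr0 add0r in e3; rewrite c'0 mulr0 add0r in e4.
  have fix1 (s t : K) : s * t = t -> t != 0 -> s = 1.
    by move=> st t0; apply: (mulIf t0); rewrite st mul1r.
  have /minor0 - /(_ c'0) minor := c0.
  (* On that plane [x] acts by diag([r], [beta * r]). The nonzero term of the minor tells which
     entry is 1 and which is [alpha]. *)
  have [ab | ab] := eqVneq (a * b') 0.
    have /andP[b0 a'0] : (b != 0) && (a' != 0).
      by rewrite -negb_or -mulf_eq0; apply: contraNneq minor => ->; rewrite ab.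
    have br : beta * r = 1 by apply: (fix1 _ b) => //; rewrite -mulrA.
    have ra : r = alpha by apply: (mulIf a'0).
    by right; congr M04; apply: (mulIf alpha0); rewrite mulVf // -br ra.
  move: ab; rewrite mulf_eq0 negb_or => /andP[a0 b'0]; left; congr M04.
  have r1 := fix1 _ _ e1 a0; rewrite r1 mul1r in e4.
  exact: (mulIf b'0).
- move=> _ e2 /esym c0 /vec3_inj[_ e4 /esym/kills c'0].
  rewrite c0 mulr0 in e2; rewrite c'0 mulr0 in e4; have b'0 := kills _ (esym e4).
  by case/negP: (minor0 c0 c'0); rewrite -e2 b'0 mulr0 mul0r.
- move=> e1 e2 /esym c0 /vec3_inj[e3 e4 /esym/kills c'0].
  rewrite c0 mulr0 add0r in e1; rewrite c0 !mulr0 !add0r e1 in e2.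
  rewrite c'0 mulr0 add0r in e3; rewrite c'0 !mulr0 !add0r e3 in e4.
  (* If [r = 1], the Jordan block has only multiples of [e 2] as eigenvectors; otherwise 1 is not an
     eigenvalue. *)
  have [r1 | r1] := eqVneq r 1.
    have a0 : a = 0 by apply: (addIr b); rewrite add0r -[in RHS]e2 r1 mul1r.
    rewrite r1 !mul1r in e3 e4; have a'0 : a' = 0.
      have [al1 | al1] := eqVneq alpha 1.
        by apply: (addIr b'); rewrite add0r -[in RHS](mul1r b') -al1 -e4 -e3.
      apply/eqP; move/eqP: e3; rewrite -subr_eq0 -{1}[a']mul1r -mulrBl mulf_eq0 subr_eq0.
      by rewrite eq_sym (negPf al1).
    by case/negP: (minor0 c0 c'0); rewrite a0 a'0 mul0r mulr0.
  have fix0 (t : K) : r * t = t -> t = 0.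
    move=> /eqP; rewrite -subr_eq0 -{2}[t]mul1r -mulrBl mulf_eq0 subr_eq0 (negPf r1).
    by move=> /eqP.
  have a0 := fix0 _ e1; rewrite a0 add0r in e2.
  by case: y0; rewrite a0 c0 (fix0 _ e2).
move=> _ /esym b0 /esym c0 /vec3_inj[_ /esym/kills b'0 /esym/kills c'0].
by case/negP: (minor0 c0 c'0); rewrite b0 b'0 mulr0 mul0r.
Qed.

(** The map exchanges [e 1] and [e 2] and sends [e 3] to [alpha *: e 3], which turns the eigenvalues
    1, [alpha^-1] of the target into [alpha], 1. *)
Lemma isomorphic_M04_inv alpha : alpha != 0 ->
  isomorphic (Malg (M04 alpha)) (Malg (M04 alpha^-1)).
Proof.
move=> alpha0.
pose f t (v : 'rV[K]_3) := vec3 (v 0 1) (v 0 0) (t * v 0 2%:R).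
have fE t a b c : f t (vec3 a b c) = vec3 b a (t * c) by rewrite /f !mxE.
have fl : linear (f alpha).
  by move=> t u v; rewrite /f scale_vec3 add_vec3 !mxE; congr vec3; ring.
pose fL := GRing.isLinear.Build K 'rV[K]_3 'rV[K]_3 *:%R (f alpha) fl.
exists (HB.pack (f alpha) fL : {linear 'rV[K]_3 -> 'rV[K]_3}); split=> [|x y].
  by exists (f alpha^-1) => x; have [a [b [c ->]]] := vec3_eta x;
    rewrite /= !fE mulrA ?mulVf ?mulfV ?mul1r.
have [a [b [c ->]]] := vec3_eta x; have [a' [b' [c' ->]]] := vec3_eta y.
change (f alpha (amul (Malg (M04 alpha)) (vec3 a b c) (vec3 a' b' c')) =
  amul (Malg (M04 alpha^-1)) (f alpha (vec3 a b c)) (f alpha (vec3 a' b' c'))).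
by rewrite mul_vec3 !fE mul_vec3; congr vec3; field.
Qed.

(** A label [M04 alpha] with [alpha] nonzero on either side is settled by eigenvalues. After that
    only [M04 0] and the parameter-free labels remain, and the other four invariants separate
    them. *)
Lemma isomorphic_MalgP (k l : label K) : isomorphic (Malg k) (Malg l) <->
  k = l \/ exists alpha, alpha != 0 /\ k = M04 alpha /\ l = M04 alpha^-1.
Proof.
split=> [kl | [-> | [alpha [alpha0 [-> ->]]]]]; last 2 first.
- exact: isomorphic_refl.
- exact: isomorphic_M04_inv.
have lk := isomorphic_sym kl.
have [[alpha [alpha0 kE]] | k0] := pselect (exists alpha, alpha != 0 /\ k = M04 alpha).
  have lE : has_eigenvalues (Malg l) alpha.
    by apply: isomorphic_has_eigenvalues kl _; rewrite kE; apply: has_eigenvalues_M04.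
  have [-> | ->] := has_eigenvalues_Malg alpha0 lE; first by left.
  by right; exists alpha.
have [[alpha [alpha0 lE]] | l0] := pselect (exists alpha, alpha != 0 /\ l = M04 alpha).
  have kE : has_eigenvalues (Malg k) alpha.
    by apply: isomorphic_has_eigenvalues lk _; rewrite lE; apply: has_eigenvalues_M04.
  have [-> | ->] := has_eigenvalues_Malg alpha0 kE; first by left.
  by right; exists alpha^-1; rewrite invr_eq0 invrK.
have {}k0 alpha : k = M04 alpha -> alpha = 0.
  by move=> kE; apply/eqP/negPn/negP => alpha0; apply: k0; exists alpha.
have {}l0 alpha : l = M04 alpha -> alpha = 0.
  by move=> lE; apply/eqP/negPn/negP => alpha0; apply: l0; exists alpha.
have assoc : associative_algebra (Malg k) <-> associative_algebra (Malg l).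
  by split; apply: isomorphic_associative.
have iso0 : isotropic_product_zero (Malg k) <-> isotropic_product_zero (Malg l).
  by split; apply: isomorphic_isotropic_product_zero.
have ann : has_annihilator (Malg k) <-> has_annihilator (Malg l).
  by split; apply: isomorphic_has_annihilator.
have line : products_in_line (Malg k) <-> products_in_line (Malg l).
  by split; apply: isomorphic_products_in_line.
have M01P := @isotropic_product_zero_M01 K; have M02P := @isotropic_product_zero_M02 K.
rewrite !associative_Malg in assoc; rewrite !has_annihilator_Malg in ann.
rewrite !products_in_line_Malg in line.
left; move: assoc iso0 ann line => [a1 a2] [i1 i2] [n1 n2] [p1 p2].
(* Among distinct labels, associativity, annihilators and [products_in_line] leave only the pair
   [M01], [M02], in both orders; two labels [M04] coincide as both parameters are zero. *)
case: k l {kl lk} k0 l0 a1 a2 i1 i2 n1 n2 p1 p2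
  => [|||s|||] [|||t|||] k0 l0 a1 a2 i1 i2 n1 n2 p1 p2 //;
  try have s0 := k0 _ erefl; try have t0 := l0 _ erefl;
  try by [case: (a1 I) | case: (a2 I) | case: (p1 I) | case: (p2 I) | case: (n1 I)
    | case: (n2 I) | case: (p1 s0) | case: (p2 t0) | case: (n1 s0) | case: (n2 t0)].
- by case: M02P; apply: i1.
- by case: M02P; apply: i2.
by rewrite s0 t0.
Qed.

End Eigenvalues.

Theorem theoremA1 (R : realType) :
  (forall A : algebra R[i],
     \dim {:A} = 3%N -> metabelian_algebra A -> commutative_algebra A ->
     ~ zero_algebra A ->
     exists l : label R[i], isomorphic A (Malg l)) /\
  (forall k l : label R[i],
     isomorphic (Malg k) (Malg l) <->
     k = l \/
     exists alpha : R[i], alpha != 0 /\ k = M04 alpha /\ l = M04 (alpha^-1)) /\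
  (associative_algebra (Malg (@M01 R[i])) /\
   associative_algebra (Malg (@M02 R[i])) /\
   associative_algebra (Malg (@M03 R[i]))).
Proof.
split=> [A d3 Ameta Acomm An0|]; first exact: classification.
split; first exact: isomorphic_MalgP.
by split; [|split]; apply/associative_Malg.
Qed.
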